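(* Let $q$ be a prime power, let $A(q)$ be Ihara's constant, and let $r\ge 1$ be an integer. Then for every real $\delta$ with $0\le\delta\le 1$ there exists a family of $q$-ary linear locally repairable codes with locality $r$, with relative distance $\delta$ and whose rate $R$ satisfies $$R\ge \frac{r}{r+1}-\frac{1}{A(q)}\cdot\frac{r}{r+1}-\delta.$$ That is, there is a sequence $(C_i)_{i\ge1}$ of nonzero $\mathbb{F}_q$-linear codes with locality $r$, where $C_i$ has length $n_i$, dimension $k_i$ and minimum distance $d_i$, such that $n_i\to\infty$, $\liminf_{i\to\infty} d_i/n_i\ge\delta$ and $\liminf_{i\to\infty} k_i/n_i\ge \frac{r}{r+1}-\frac{1}{A(q)}\frac{r}{r+1}-\delta$.
   Context: Locality: let $C\subseteq\mathbb{F}_q^n$ be a code. For $\alpha\in\mathbb{F}_q$ and $i\in\{1,\dots,n\}$ put $C(i,\alpha)=\{(c_1,\dots,c_n)\in C: c_i=\alpha\}$, and for $I\subseteq\{1,\dots,n\}\setminus\{i\}$ let $C_I(i,\alpha)$ be the projection of $C(i,\alpha)$ on the coordinates in $I$. $C$ is a locally repairable code with locality $r$ if for every $i\in\{1,\dots,n\}$ there is a subset $I_i\subseteq\{1,\dots,n\}\setminus\{i\}$ with $|I_i|\le r$ such that $C_{I_i}(i,\alpha)$ and $C_{I_i}(i,\beta)$ are disjoint for all $\alpha\ne\beta$ in $\mathbb{F}_q$. Ihara's constant: for an integer $g\ge 0$ let $N_q(g)$ be the maximum number of rational (degree one) places of an algebraic function field of genus $g$ with full constant field $\mathbb{F}_q$.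 Then $A(q)=\limsup_{g\to\infty} N_q(g)/g$. *)

(* Defs.v *)
From HB Require Import structures.
From mathcomp Require Import all_boot all_order all_algebra.
From mathcomp Require Import all_classical all_reals all_analysis.

Set Implicit Arguments.
Unset Strict Implicit.
Unset Printing Implicit Defensive.

Import Order.TTheory GRing.Theory Num.Theory.

Local Open Scope classical_set_scope.
Local Open Scope card_scope.
Local Open Scope ring_scope.

(** * Algebraic function fields in one variable *)

(* The simple extension K(x) inside F, for an embedding iota of K into F. *)
Definition simple_ext (K F : fieldType) (iota : {rmorphism K -> F}) (x : F) :
    set F :=
  [set y | exists p q : {poly K}, (map_poly iota q).[x] != 0 /\
     y = (map_poly iota p).[x] / (map_poly iota q).[x]].

Definition finite_over (F : fieldType) (L : set F) : Prop :=
  exists b : seq F, forall y, exists c : nat -> F,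
    (forall i, L (c i)) /\ y = \sum_(i < size b) c i * b`_i.

Record functionField (K : fieldType) := FunctionField {
  ff_field :> fieldType ;
  ff_const : {rmorphism K -> ff_field} ;
  ff_finite : exists x, ~ algebraicOver ff_const x /\
                        finite_over (simple_ext ff_const x) ;
  ff_full_constants : forall y, algebraicOver ff_const y ->
                        exists c, y = ff_const c }.

(* A place is encoded by its valuation ring O; the place itself, as an ideal,
   is [max_ideal O], the set of nonunits of O. *)
Definition valuation_ring (K : fieldType) (E : functionField K) (O : set E) :
    Prop :=
  [/\ range (ff_const E) `<` O, O `<` setT,
      forall x y, O x -> O y -> O (x - y) /\ O (x * y)
    & forall z, O z \/ O z^-1].

Definition val_unit (K : fieldType) (E : functionField K) (O : set E) : set E :=
  [set u | [/\ O u, u != 0 & O u^-1]].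

Definition max_ideal (K : fieldType) (E : functionField K) (O : set E) :
    set E :=
  O `\` val_unit O.

Definition uniformizer (K : fieldType) (E : functionField K) (O : set E)
    (t : E) : Prop :=
  max_ideal O = [set t * y | y in O].

(* The discrete valuation of a nonzero z at the place of O: z = t ^ n * u with
   t a uniformizer and u a unit. The value at z = 0 is irrelevant. *)
Definition ord (K : fieldType) (E : functionField K) (O : set E) (z : E) : int :=
  xget 0 [set n : int | exists t u : E,
    [/\ uniformizer O t, val_unit O u & z = t ^ n * u]].

(* d is the K-dimension of V / W, for K-subspaces W of V of E: there are d
   vectors of V whose classes form a basis. *)
Definition has_quot_dim (K : fieldType) (E : functionField K) (V W : set E)
    (d : nat) : Prop :=
  exists b : 'I_d -> E, (forall i, V (b i)) /\
    forall v, V v -> exists! c : 'rV[K]_d,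
      W (v - \sum_i ff_const E (c 0 i) * b i).

Definition quot_dim (K : fieldType) (E : functionField K) (V W : set E) : nat :=
  xget 0%N [set d | has_quot_dim V W d].

Definition place_degree (K : fieldType) (E : functionField K) (O : set E) :
    nat :=
  quot_dim O (max_ideal O).

Definition rational_places (K : fieldType) (E : functionField K) :
    set (set E) :=
  [set O | valuation_ring O /\ place_degree O = 1%N].
Arguments rational_places {K} E _.

Definition is_divisor (K : fieldType) (E : functionField K)
    (A : set E -> int) : Prop :=
  finite_set [set O | A O != 0] /\ forall O, A O != 0 -> valuation_ring O.

Definition div_degree (K : fieldType) (E : functionField K)
    (A : set E -> int) : int :=
  \sum_(O \in [set O : set E | valuation_ring O]) A O * (place_degree O)%:Z.

Definition riemann_roch_space (K : fieldType) (E : functionField K)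
    (A : set E -> int) : set E :=
  [set z | z = 0 \/ forall O, valuation_ring O -> - A O <= ord O z].

Definition ell (K : fieldType) (E : functionField K) (A : set E -> int) : nat :=
  quot_dim (riemann_roch_space A) [set 0].

(* The genus is max {deg A - ell A + 1 | A a divisor}. *)
Definition has_genus (K : fieldType) (E : functionField K) (g : nat) : Prop :=
  (exists2 A : set E -> int, is_divisor A &
     div_degree A - (ell A)%:Z + 1 = g%:Z) /\
  (forall A : set E -> int, is_divisor A ->
     div_degree A - (ell A)%:Z + 1 <= g%:Z).

(** * Ihara's constant *)

(* N_q(g) for q = #|K|. The maximum exists for every g, so the default value 0
   of [xget] is never used. *)
Definition max_rational_places (K : finFieldType) (g : nat) : nat :=
  xget 0%N [set N |
    (exists E : functionField K, has_genus E g /\ rational_places E #= `I_N) /\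
    (forall E : functionField K, has_genus E g ->
       rational_places E #<= `I_N)].

(* A(q) for q = #|K|, as an extended real number. *)
Definition ihara (R : realType) (K : finFieldType) : \bar R :=
  limn_esup (fun g => ((max_rational_places K g)%:R / g%:R)%:E).

(** * Codes *)

Local Close Scope card_scope.
Local Close Scope classical_set_scope.

(* C(i, alpha) *)
Definition code_fiber (K : finFieldType) (n : nat) (C : {set 'rV[K]_n})
    (i : 'I_n) (alpha : K) : {set 'rV[K]_n} :=
  [set c in C | c 0 i == alpha].

Definition proj_coords (K : finFieldType) (n : nat) (I : {set 'I_n})
    (c : 'rV[K]_n) : 'rV[K]_#|I| :=
  \row_k c 0 (enum_val k).

Definition has_locality (K : finFieldType) (n : nat) (C : {set 'rV[K]_n})
    (r : nat) : Prop :=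
  forall i : 'I_n, exists I : {set 'I_n},
    [/\ i \notin I, (#|I| <= r)%N &
        forall alpha beta : K, alpha != beta ->
          [disjoint proj_coords I @: code_fiber C i alpha
                  & proj_coords I @: code_fiber C i beta]].

Definition hamming_dist (K : finFieldType) (n : nat) (x y : 'rV[K]_n) : nat :=
  #|[set j | x 0 j != y 0 j]|.

(* The default value n does not affect the minimum when C has at least two
   words, since Hamming distances are at most n. *)
Definition min_distance (K : finFieldType) (n : nat) (C : {set 'rV[K]_n}) :
    nat :=
  \big[minn/n]_(x in C) \big[minn/n]_(y in C | y != x) hamming_dist x y.

Definition codewords (K : finFieldType) (n : nat) (C : {vspace 'rV[K]_n}) :
    {set 'rV[K]_n} :=
  [set c in C].

(* Main.v *)
Require Import Defs.
From HB Require Import structures.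
From mathcomp Require Import all_boot all_order all_algebra.
From mathcomp Require Import all_classical all_reals all_analysis.
From mathcomp Require Import zify ring lra.

(** Let s = r/(r+1). If the lower bound on the rate is not positive, repetition
    codes suffice. Otherwise A(q) > 1, and there are function fields of large
    genus g with N > a g rational places for every a < A(q). Evaluating L(m P_0)
    at the other rational places gives a linear code in which a nonzero word
    has at most m zeros, of dimension at least m - g + 1. Cutting the coordinates
    into blocks of length r and appending to each block its parity check
    keeps the dimension and the distance, multiplies the length by 1/s and
    produces locality r; with N = s n the bound 1 - 1/A(q) - d/N on the
    rate k/N becomes s - s/A(q) - d/n on k/n.

    Because the genus is defined as a supremum over divisors, Riemann's
    inequality is built in. The bound m on the number of zeros also comes from
    the genus, see [rrspace_degree_ge0]; it needs neither the degree of
    principal divisors nor the finiteness of their support. That all places are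
    discrete valuation rings, in contrast, must be proved: it follows from
    the finiteness of a function field over K(x) for every transcendental x. *)

Set Implicit Arguments.
Unset Strict Implicit.
Unset Printing Implicit Defensive.

Import Order.TTheory GRing.Theory Num.Theory.

Local Open Scope ring_scope.

(** * Linear codes and locality *)

Section Codes.
Variable K : finFieldType.

Definition weight n (c : 'rV[K]_n) : nat := #|[set j | c 0 j != 0]|.

Lemma card_zeros_weight n (c : 'rV[K]_n) :
  (#|[set j | c 0%R j == 0%R]| + weight c)%N = n.
Proof.
rewrite -[RHS]card_ord -(cardsC [set j | c 0 j == 0]); congr (_ + _)%N.
by apply: eq_card => j; rewrite !inE.
Qed.

(** A point common to two projected fibres comes from two codewords that agree on [I] but differ at
    [i]. Locality is thus checked as recoverability of coordinate [i] from those in [I]. *)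
Lemma has_locality_determined n (C : {set 'rV[K]_n}) r :
  (forall i, exists I : {set 'I_n}, [/\ i \notin I, (#|I| <= r)%N &
     forall c c', c \in C -> c' \in C -> (forall l, l \in I -> c 0 l = c' 0 l) ->
       c 0 i = c' 0 i]) ->
  has_locality C r.
Proof.
move=> h i; have [I [iI cardI det]] := h i; exists I; split=> // alpha beta ab.
apply/pred0P => p /=; apply/negP => /andP[/imsetP[c]].
rewrite inE => /andP[cC /eqP ci] -> /imsetP[c']; rewrite inE => /andP[c'C /eqP c'i] e.
case/eqP: ab; rewrite -ci -c'i; apply: det => // l lI.
have /rowP/(_ (enum_rank_in lI l)) := e.
by rewrite !mxE enum_rankK_in.
Qed.

Definition generated_code k n (H : 'M[K]_(k, n)) : {vspace 'rV[K]_n} :=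
  limg (linfun (mulmxr H)).

Lemma generated_codeP k n (H : 'M[K]_(k, n)) c :
  reflect (exists u : 'rV[K]_k, c = u *m H) (c \in generated_code H).
Proof.
apply: (iffP memv_imgP) => [[u _ ->]|[u ->]]; exists u; rewrite ?memvf ?lfunE //.
Qed.

Section Generator.
Variables (k n w : nat) (H : 'M[K]_(k, n)).
Hypothesis weightH : forall u, u != 0 -> (w <= weight (u *m H))%N.

(** A nonzero message encoded as 0 would have weight 0 < [w], so encoding is injective. *)
Lemma generated_code_dim : (0 < w)%N -> \dim (generated_code H) = k.
Proof.
move=> w0.
have weight0 : weight (0 : 'rV[K]_n) = 0%N.
  by apply: eq_card0 => j; rewrite inE mxE eqxx.
have H_inj (u : 'rV[K]_k) : u *m H = 0 -> u = 0.
  move=> uH; apply/eqP; apply: contraT => /weightH.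
  by rewrite uH weight0 leqNgt w0.
rewrite limg_dim_eq; first by rewrite dimvf /dim /= mul1n.
apply/eqP; rewrite capfv -subv0; apply/subvP => u.
by rewrite memv_ker lfunE memv0 => /eqP /H_inj ->.
Qed.

(** By linearity, distances are weights of nonzero codewords. The hypothesis [w <= n] covers the
    default value [n] of both nested minima. *)
Lemma generated_code_distance :
  (w <= n)%N -> (w <= min_distance (codewords (generated_code H)))%N.
Proof.
move=> wn; rewrite /min_distance.
apply: (big_ind (fun m => w <= m)%N) => // [x y|x]; first by rewrite leq_min => -> ->.
rewrite inE => /generated_codeP[u ->].
apply: (big_ind (fun m => w <= m)%N) => // [x' y|y]; first by rewrite leq_min => -> ->.
rewrite inE => /andP[/generated_codeP[v ->] vu].
have -> : hamming_dist (u *m H) (v *m H) = weight ((u - v) *m H).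
  apply: eq_card => j; rewrite !inE -subr_eq0.
  by rewrite (_ : ((u - v) *m H) 0 j = (u *m H) 0 j - (v *m H) 0 j) // mulmxBl !mxE.
by apply: weightH; rewrite subr_eq0; apply: contraNneq vu => ->.
Qed.

End Generator.

Lemma generated_code_neq0 k n (H : 'M[K]_(k, n)) :
  (0 < \dim (generated_code H))%N -> generated_code H != 0%VS.
Proof. by rewrite lt0n dimv_eq0. Qed.

Lemma repetition_code (r n : nat) : (0 < r)%N -> (1 < n)%N ->
  exists C : {vspace 'rV[K]_n}, [/\ C != 0%VS, has_locality (codewords C) r &
    (n <= min_distance (codewords C))%N].
Proof.
move=> r0 n1; pose H : 'M[K]_(1, n) := const_mx 1.
have uH (u : 'rV_1) j : (u *m H) 0 j = u 0 0 by rewrite mxE big_ord1 mxE mulr1.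
have weightH u : u != 0 -> (n <= weight (u *m H))%N.
  move=> /rV0Pn[j]; rewrite ord1 => u0.
  rewrite /weight (_ : [set _ | _] = finset.setT) ?cardsT ?card_ord //.
  by apply/setP => l; rewrite !inE uH u0.
exists (generated_code H); split.
- by apply: generated_code_neq0; rewrite (generated_code_dim weightH) // ltnW.
- apply: has_locality_determined => i.
  (* Any other coordinate repairs [i]; 0 and 1 are both available because [1 < n]. *)
  have [l il] : exists l : 'I_n, i != l.
    have [i0|i0] := eqVneq (i : nat) 0%N; last by exists (Ordinal (ltnW n1)).
    by exists (Ordinal n1); rewrite -val_eqE /= i0.
  exists [set l]; split; rewrite ?inE // ?cards1 //.
  move=> c c'; rewrite !inE => /generated_codeP[u ->] /generated_codeP[v ->].
  by move=> /(_ l); rewrite inE !uH; apply.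
- exact: generated_code_distance weightH _.
Qed.

(** * Parity checks on blocks *)

Section ParityExtension.
Variables (r B k : nat) (G : 'M[K]_(k, B * r)).

(** [mxvec_index b j] stands for position [j] of block [b]; position [ord_max] holds the check
    symbol. *)
Definition parity_extension : 'M[K]_(k, B * r.+1) :=
  \matrix_i mxvec (\matrix_(b, j)
    if unlift ord_max j is Some l then G i (mxvec_index b l)
    else - \sum_l G i (mxvec_index b l)).

Lemma parity_extension_data (u : 'rV[K]_k) b l :
  (u *m parity_extension) 0 (mxvec_index b (lift ord_max l)) =
  (u *m G) 0 (mxvec_index b l).
Proof. by rewrite !mxE; apply: eq_bigr => i _; rewrite mxE mxvecE mxE liftK. Qed.

Lemma parity_extension_check (u : 'rV[K]_k) b :
  \sum_j (u *m parity_extension) 0 (mxvec_index b j) = 0.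
Proof.
rewrite big_ord_recr /=.
have -> : (u *m parity_extension) 0 (mxvec_index b ord_max) =
    - \sum_l (u *m G) 0 (mxvec_index b l).
  rewrite mxE; under eq_bigr do rewrite mxE mxvecE mxE unlift_none mulrN mulr_sumr.
  by rewrite sumrN exchange_big; congr (- _); apply: eq_bigr => l _; rewrite mxE.
apply/eqP; rewrite subr_eq0; apply/eqP/eq_bigr => l _.
rewrite -parity_extension_data; congr (_ 0 (mxvec_index b _)).
by apply/val_inj/esym/lift_max.
Qed.

Lemma parity_extension_weight (u : 'rV[K]_k) :
  (weight (u *m G) <= weight (u *m parity_extension))%N.
Proof.
(* [h] moves a data coordinate to its place in the extended word. It is injective and preserves
   entries, so it embeds one support into the other. *)
pose h (l : 'I_(B * r)) := let: isMxvecIndex b j := mxvec_indexP l in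
  mxvec_index b (lift ord_max j).
have hE l : (u *m parity_extension) 0 (h l) = (u *m G) 0 l.
  by rewrite /h; case: mxvec_indexP => b j; rewrite parity_extension_data.
have index_inj m n : injective (uncurry (@mxvec_index m n)).
  by apply: bij_inj; apply: onT_bij; exact: curry_mxvec_bij.
have h_inj : injective h.
  move=> l l'; rewrite /h; case: mxvec_indexP => b j; case: mxvec_indexP => b' j'.
  move=> /(@index_inj _ _ (_, _) (_, _)) e.
  by have /= [-> /lift_inj ->] := (congr1 fst e, congr1 snd e).
rewrite /weight -(card_imset _ h_inj).
apply/subset_leq_card/fintype.subsetP => l' /imsetP[l].
by rewrite inE => ul ->; rewrite inE hE.
Qed.

(** Each block sums to 0, so any of its [r + 1] entries, the check symbol included, is determined by
    the other [r]. *)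
Lemma parity_extension_locality :
  has_locality (codewords (generated_code parity_extension)) r.
Proof.
apply: has_locality_determined => i; case/mxvec_indexP: i => b j.
exists [set mxvec_index b l | l in [set~ j]]; split.
- apply/imsetP => -[l]; rewrite !inE => lj.
  have index_inj : injective (uncurry (@mxvec_index B r.+1)).
    by apply: bij_inj; apply: onT_bij; exact: curry_mxvec_bij.
  by move=> /(@index_inj (_, _) (_, _)) /(congr1 snd) /= e; rewrite e eqxx in lj.
- by apply: leq_trans (leq_imset_card _ _) _; rewrite cardsC1 card_ord.
- move=> c c'; rewrite !inE => /generated_codeP[u ->] /generated_codeP[v ->] e.
  have := etrans (parity_extension_check u b) (esym (parity_extension_check v b)).
  rewrite (bigD1 j) //= [in RHS](bigD1 j) //=.
  rewrite (eq_bigr (fun l => (v *m parity_extension) 0 (mxvec_index b l))) => [|l lj].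
    exact: addIr.
  by apply: e; apply: imset_f; rewrite !inE.
Qed.

End ParityExtension.

Lemma locally_repairable_of_generator (r B k w : nat) (G : 'M[K]_(k, B * r)) :
  (0 < w)%N -> (w <= B * r)%N -> (0 < k)%N ->
  (forall u, u != 0 -> (w <= weight (u *m G))%N) ->
  exists C : {vspace 'rV[K]_(B * r.+1)}, [/\ C != 0%VS,
    has_locality (codewords C) r, (w <= min_distance (codewords C))%N & \dim C = k].
Proof.
move=> w0 wB k0 weightG.
have weightH u : u != 0 -> (w <= weight (u *m parity_extension G))%N.
  by move=> /weightG wu; apply: leq_trans wu _; apply: parity_extension_weight.
have dimC := generated_code_dim weightH w0.
exists (generated_code (parity_extension G)); split=> //.
- by apply: generated_code_neq0; rewrite dimC.
- exact: parity_extension_locality.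
- apply: generated_code_distance => //.
  by rewrite (leq_trans wB) // leq_mul2l leqnSn orbT.
Qed.

End Codes.

Local Open Scope classical_set_scope.

(** * Finiteness of E over K(x) *)

Lemma rowspace_dependent (K : fieldType) (m n : nat) (A : 'M[K]_(m, n)) :
  (n < m)%N -> exists2 u : 'rV[K]_m, u != 0 & u *m A = 0.
Proof.
move=> ltnm; have kA0 : kermx A != 0.
  rewrite kermx_eq0 /row_free neq_ltn; apply/orP; left.
  exact: leq_ltn_trans (rank_leq_col A) ltnm.
case/rowV0Pn: kA0 => u /sub_kermxP uA u0.
by exists u.
Qed.

Section FunctionField.
Variables (K : fieldType) (E : functionField K).

Local Notation iota := (ff_const E).

Section Counting.
Variables (x0 : E) (b : seq E).

Local Notation ev p := (map_poly iota p).[x0].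

(** Bounding the size of the coefficients gives a K-space of dimension at most [size b * S], which
    turns linear algebra over K(x0) into counting over K. *)
Definition poly_span (S : nat) : set E :=
  [set y | exists p : 'I_(size b) -> {poly K}, (forall k, size (p k) <= S)%N /\
     y = \sum_k ev (p k) * b`_k].

Lemma poly_span_le (S S' : nat) (y : E) :
  (S <= S')%N -> poly_span S y -> poly_span S' y.
Proof.
by move=> leS [p [sp ->]]; exists p; split=> // k; apply: leq_trans (sp k) leS.
Qed.

Lemma poly_spanM (S D : nat) (h : {poly K}) (y : E) :
  (size h <= D)%N -> poly_span S y -> poly_span (S + D) (ev h * y).
Proof.
move=> sh [p [sp ->]]; exists (fun k => h * p k); split=> [k|].
  by have := size_polyMleq h (p k); have := sp k; lia.
rewrite mulr_sumr; apply: eq_bigr => k _.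
by rewrite rmorphM hornerM mulrA.
Qed.

Lemma poly_span_sum (I : finType) (S : nat) (y : I -> E) :
  (forall i, poly_span S (y i)) -> poly_span S (\sum_i y i).
Proof.
move=> /choice[p hp]; exists (fun k => \sum_i p i k); split=> [k|].
  apply: leq_trans (size_sum _ _ _) _; apply/bigmax_leqP => i _.
  by have [->] := hp i.
rewrite (eq_bigr _ (fun i _ => (hp i).2)) exchange_big /=; apply: eq_bigr => k _.
by rewrite rmorph_sum horner_sum mulr_suml.
Qed.

(** Row [i] of [A] lists the [size b * S] coefficients of one representation of [y i]. There are
    more rows than columns, and a relation between the rows carries over to the [y i]. *)
Lemma poly_span_dependent (I : finType) (S : nat) (y : I -> E) :
  (size b * S < #|I|)%N -> (forall i, poly_span S (y i)) ->
  exists2 u : I -> K, exists i, u i != 0 & \sum_i iota (u i) * y i = 0.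
Proof.
move=> ltI /choice[p hp].
pose A := \matrix_(l < #|I|) mxvec (\matrix_(k < size b, s < S) (p (enum_val l) k)`_s).
have [u /rV0Pn[l ul] uA] := rowspace_dependent A ltI.
exists (fun i => u 0 (enum_rank i)); first by exists (enum_val l); rewrite enum_valK.
under eq_bigr do rewrite (hp _).2 mulr_sumr.
rewrite exchange_big big1 //= => k _.
under eq_bigr do rewrite mulrA -hornerZ -map_polyZ.
rewrite -mulr_suml -horner_sum -rmorph_sum.
suff -> : \sum_i u 0 (enum_rank i) *: p i k = 0 by rewrite rmorph0 horner0 mul0r.
apply/polyP => s; rewrite coef0 coef_sum.
have [ltsS|leSs] := ltnP s S; last first.
  rewrite big1 // => i _; rewrite coefZ nth_default ?mulr0 //.
  by apply: leq_trans leSs; have [] := hp i.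
have /rowP/(_ (mxvec_index k (Ordinal ltsS))) := uA.
rewrite !mxE => uAk; apply: etrans uAk.
rewrite (reindex (@enum_val I predT)) /=; last exact: onW_bij (enum_val_bij I).
apply: eq_bigr => i _.
by rewrite coefZ enum_valK /A mxE mxvecE mxE.
Qed.

Hypothesis bspan : forall y, exists c : nat -> E,
  (forall i, simple_ext iota x0 (c i)) /\ y = \sum_(i < size b) c i * b`_i.

Lemma common_denominator (I : finType) (y : I -> E) :
  exists (h : {poly K}) (S : nat),
    ev h != 0 /\ forall i, poly_span S (ev h * y i).
Proof.
have /choice[c hc] i := bspan (y i).
have /choice[p hp] (ik : I * 'I_(size b)) := (hc ik.1).1 ik.2.
have /choice[q hq] := hp.
(* The product of the denominators of all coefficients of all [y i]. *)
exists (\prod_ik q ik).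
exists (\max_(ik : I * 'I_(size b)) size (p ik * \prod_(jl | jl != ik) q jl)%R).
split.
  rewrite rmorph_prod horner_prod; apply/prodf_neq0 => ik _; exact: (hq ik).1.
move=> i; exists (fun k => p (i, k) * \prod_(jl | jl != (i, k)) q jl); split=> [k|].
  exact: (leq_bigmax (F := fun ik => size (p ik * \prod_(jl | jl != ik) q jl)%R)).
rewrite (hc i).2 mulr_sumr; apply: eq_bigr => k _.
rewrite (bigD1 (i, k)) //= rmorphM hornerM.
have [q0 ->] := hq (i, k).
rewrite rmorphM hornerM /=; field.
exact: q0.
Qed.

(* [E : K(x)] is finite: multiplying by the common denominators of x and of the
   y_i puts the c N elements y_i x^j in a space of dimension n (e + N D), which
   is less than c N for c = n D + 1 and N large. *)
Lemma dependent_powers_of_span (x : E) : exists c : nat, forall y : 'I_c -> E,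
  exists N, exists2 a : 'I_c -> 'I_N -> K, exists i j, a i j != 0 &
    \sum_i \sum_j iota (a i j) * (y i * x ^+ j) = 0.
Proof.
have [h [S [h0 hS]]] := common_denominator (fun k : 'I_(size b) => x * b`_k).
(* [D] bounds the growth of coefficient sizes under multiplication by [ev h * x] (at most [S]) and
   by [ev h] (at most [size h]). *)
pose D := maxn S (size h).
have hxM e z : poly_span e z -> poly_span (e + D) (ev h * x * z).
  case=> p [sp ->].
  rewrite mulr_sumr; apply: poly_span_sum => k.
  rewrite mulrCA -(mulrA (ev h)) addnC.
  have := poly_spanM (sp k) (hS k).
  by apply: poly_span_le; rewrite addnC [X in (_ <= X)%N]addnC leq_add2l leq_maxl.
have hxjM e z j : poly_span e z -> poly_span (e + j * D) ((ev h * x) ^+ j * z).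
  move=> sz; elim: j => [|j IHj]; first by rewrite expr0 mul1r mul0n addn0.
  by rewrite exprS -mulrA; move: (hxM _ _ IHj); apply: poly_span_le; lia.
have hjM e z j : poly_span e z -> poly_span (e + j * D) (ev h ^+ j * z).
  move=> sz; elim: j => [|j IHj]; first by rewrite expr0 mul1r mul0n addn0.
  rewrite exprS -mulrA; have := poly_spanM (leq_maxr S (size h)) IHj.
  by apply: poly_span_le; rewrite -/D; lia.
exists (size b * D).+1 => y.
have [H [e [H0 He]]] := common_denominator y.
(* As [N] exceeds [size b * e], the dimension [size b * (e + N * D)] is below
   [(size b * D + 1) * N]. *)
pose N := (size b * e).+1; exists N.
have span_w (ij : 'I_(size b * D).+1 * 'I_N) : poly_span (e + N * D)
    (ev h ^+ N * ev H * (y ij.1 * x ^+ ij.2)).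
  case: ij => i j /=.
  (* Of the [N] factors [ev h], [j] go with the powers of [x] and [N - j] remain, so all products
     land in the same span. *)
  have := hjM _ _ (N - j)%N (hxjM _ _ j (He i)).
  rewrite -addnA -mulnDl subnKC; last exact: ltnW.
  have -> : ev h ^+ N = ev h ^+ (N - j) * ev h ^+ j by rewrite -exprD subnK // ltnW.
  have -> // : ev h ^+ (N - j) * (((ev h) * x) ^+ j * (ev H * y i)) =
    ev h ^+ (N - j) * ev h ^+ j * ev H * (y i * x ^+ j) by rewrite exprMn; ring.
have [|u [[i j] uij] hu] := poly_span_dependent _ span_w.
  by rewrite card_prod !card_ord /N; nia.
exists (fun i j => u (i, j)); first by exists i, j.
have hH0 : ev h ^+ N * ev H != 0 by rewrite mulf_neq0 // expf_neq0.
apply: (mulfI hH0); rewrite mulr0 -[RHS]hu.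
rewrite pair_big /= mulr_sumr; apply: eq_bigr => -[i' j'] _ /=.
by rewrite mulrCA.
Qed.

End Counting.

(** For transcendental [x] this says [E : K(x)] < [c]: the [a i j] are coefficients of polynomials
    in [x] that relate the [y i]. Being a relation over K, it can be played against families with
    distinct valuations. *)
Lemma dependent_powers (x : E) : exists c : nat, forall y : 'I_c -> E,
  exists N, exists2 a : 'I_c -> 'I_N -> K, exists i j, a i j != 0 &
    \sum_i \sum_j iota (a i j) * (y i * x ^+ j) = 0.
Proof.
have [x0 [_ [b hb]]] := ff_finite E.
exact: dependent_powers_of_span hb x.
Qed.

End FunctionField.

(** * Places are discrete valuation rings *)

Section ValuationRing.
Variables (K : fieldType) (E : functionField K).

Local Notation iota := (ff_const E).

Variables (O : set E) (Oval : valuation_ring O).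

Local Notation P := (max_ideal O).

Lemma vring_const c : O (iota c).
Proof. by case: Oval => -[sub _] _ _ _; apply: sub; exists c. Qed.

Lemma vring0 : O 0.
Proof. by rewrite -(rmorph0 iota); apply: vring_const. Qed.

Lemma vring1 : O 1.
Proof. by rewrite -(rmorph1 iota); apply: vring_const. Qed.

Lemma vringB x y : O x -> O y -> O (x - y).
Proof. by case: Oval => _ _ H _ Ox Oy; case: (H x y Ox Oy). Qed.

Lemma vringM x y : O x -> O y -> O (x * y).
Proof. by case: Oval => _ _ H _ Ox Oy; case: (H x y Ox Oy). Qed.

Lemma vringN x : O x -> O (- x).
Proof. by rewrite -sub0r; apply: vringB vring0. Qed.

Lemma vringD x y : O x -> O y -> O (x + y).
Proof. by move=> Ox Oy; rewrite -(opprK y); apply: vringB => //; apply: vringN. Qed.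

Lemma vringX x n : O x -> O (x ^+ n).
Proof.
by move=> Ox; elim: n => [|n IHn]; [exact: vring1 | rewrite exprS; exact: vringM].
Qed.

Lemma vring_sum (I : finType) (A : pred I) (f : I -> E) :
  (forall i, A i -> O (f i)) -> O (\sum_(i | A i) f i).
Proof. by move=> h; apply: (big_ind O) h; [exact: vring0 | exact: vringD]. Qed.

Lemma vringV x : O x \/ O x^-1.
Proof. by case: Oval. Qed.

Lemma max_idealE x : P x <-> O x /\ (x != 0 -> ~ O x^-1).
Proof.
rewrite /max_ideal /val_unit /=; split=> -[Ox h]; split=> //.
  by move=> x0 Ox'; apply: h.
by case=> _ x0; apply: h.
Qed.

Lemma max_ideal0 : P 0.
Proof. by apply/max_idealE; split; [exact: vring0 | rewrite eqxx]. Qed.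

Lemma max_ideal_vring x : P x -> O x.
Proof. by case. Qed.

Lemma max_idealV x : x != 0 -> P x <-> ~ O x^-1.
Proof.
move=> x0; rewrite max_idealE; split; first by case=> _; apply.
by move=> nO; split=> //; case: (vringV x).
Qed.

Lemma max_idealMl x y : O x -> P y -> P (x * y).
Proof.
move=> Ox; have [->|x0] := eqVneq x 0; first by rewrite mul0r => _; apply: max_ideal0.
have [->|y0] := eqVneq y 0; first by rewrite mulr0 => _; apply: max_ideal0.
rewrite !max_idealV ?mulf_neq0 // => nO Oxy; apply: nO.
have -> : y^-1 = x * (x * y)^-1 by field; rewrite y0 x0.
exact: vringM.
Qed.

Lemma max_idealMr x y : P x -> O y -> P (x * y).
Proof. by move=> Px Oy; rewrite mulrC; apply: max_idealMl. Qed.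

Lemma max_ideal1 : ~ P 1.
Proof. by rewrite max_idealV ?oner_eq0 // invr1 => /(_ vring1). Qed.

Lemma max_idealD x y : P x -> P y -> P (x + y).
Proof.
have [->|x0] := eqVneq x 0; first by rewrite add0r.
have [->|y0] := eqVneq y 0; first by rewrite addr0.
move=> Px Py; have [h|h] := vringV (x / y).
  have -> : x + y = (x / y + 1) * y by field.
  by apply: max_idealMl => //; apply: vringD => //; apply: vring1.
have -> : x + y = ((x / y)^-1 + 1) * x by field; rewrite x0 y0.
by apply: max_idealMl => //; apply: vringD => //; apply: vring1.
Qed.

Lemma max_ideal_sum (I : finType) (A : pred I) (f : I -> E) :
  (forall i, A i -> P (f i)) -> P (\sum_(i | A i) f i).
Proof. by move=> h; apply: (big_ind P) h; [exact: max_ideal0 | exact: max_idealD]. Qed.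

Lemma max_idealB x y : P x -> P y -> P (x - y).
Proof.
move=> Px Py; apply: max_idealD => //; rewrite -mulN1r; apply: max_idealMl => //.
by apply: vringN; apply: vring1.
Qed.

Lemma max_ideal_const c : P (iota c) -> c = 0.
Proof.
move=> Pc; apply/eqP/negP => /negP c0; apply: max_ideal1.
rewrite -(rmorph1 iota) -(mulVf c0) rmorphM; apply: max_idealMl => //.
exact: vring_const.
Qed.

(* A nontrivial K-combination of elements with pairwise distinct valuations has
   the valuation of its dominant term, so it does not vanish. *)
Lemma distinct_valuations_free (I : finType) (w : I -> E) (a : I -> K) :
  (forall i, w i != 0) ->
  (forall i j, i != j -> P (w i / w j) \/ P (w j / w i)) ->
  \sum_i iota (a i) * w i = 0 -> forall i, a i = 0.
Proof.
move=> w0 wP sum0 i; apply/eqP/negP => /negP ai.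
pose o : rel I := fun i j => `[< O (w j / w i) >].
have o_refl : reflexive o by move=> j; apply/asboolP; rewrite divff //; apply: vring1.
have o_trans : transitive o.
  move=> k j l /asboolP jk /asboolP kl; apply/asboolP.
  have -> : w l / w j = (w l / w k) * (w k / w j) by field; rewrite !w0.
  exact: vringM.
have o_total : total o.
  move=> j k; case: (vringV (w k / w j)) => h;
    apply/orP; [left|right]; apply/asboolP => //.
  by rewrite invf_div in h.
have [m am minm] := @extremumP _ _ o i (fun j => a j != 0) id o_refl o_trans o_total ai.
apply/negP: am; rewrite negbK; apply/eqP/max_ideal_const.
have -> : iota (a m) = - (\sum_(j | j != m) iota (a j) * (w j / w m)).
  apply/eqP; rewrite -addr_eq0; apply/eqP.
  have := congr1 (fun z => z / w m) sum0; rewrite mul0r mulr_suml (bigD1 m) //= mulfK //.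
  by under eq_bigr do rewrite -mulrA.
rewrite -sub0r; apply: max_idealB max_ideal0 _; apply: max_ideal_sum => j jm.
have [->|aj] := eqVneq (a j) 0; first by rewrite rmorph0 mul0r; apply: max_ideal0.
apply: max_idealMl; first exact: vring_const.
have := minm j aj => /asboolP Ojm.
case: (wP j m jm) => // /max_idealE[_]; rewrite invf_div => /(_ _ Ojm) [].
by rewrite mulf_neq0 // invr_eq0.
Qed.

(** Without a generator of the maximal ideal there is an infinite chain v(x) = v(y_0) > v(y_1) > ...
    > 0. Then all y_i x^j have distinct valuations, against [dependent_powers] for [x]. *)
Lemma exists_uniformizer : exists t, uniformizer O t.
Proof.
apply/not_existsP => noU.
(* Since [y] does not generate [P], some [z] in [P] lies outside [y O]; then [z / y] is not in [O],
   so [y / z] is in [P]. *)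
have step y : exists z, P y -> y != 0 -> [/\ P z, z != 0 & P (y / z)].
  apply/not_existsP => h.
  have [Py y0] : P y /\ y != 0 by apply: contrapT => n; apply: (h 0) => ? ?; case: n.
  apply: (noU y); apply/seteqP; split=> z; last by case=> u Ou <-; apply: max_idealMr.
  move=> Pz; apply: contrapT => nz; apply: (h z) => _ _.
  have z0 : z != 0.
    by apply: contra_notN nz => /eqP ->; exists 0; rewrite ?mulr0 //; apply: vring0.
  split=> //; apply/max_idealV; first by rewrite mulf_neq0 // invr_eq0.
  rewrite invf_div => Ozy; apply: nz; exists (z / y) => //.
  by rewrite mulrC divfK.
have [x Px x0] : exists2 x, P x & x != 0.
  case: Oval => _ [_ nT] _ _; apply: contrapT => h; apply: nT => z _.
  apply: contrapT => nOz; have z0 : z != 0.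
    by apply: contra_notN nOz => /eqP ->; apply: vring0.
  apply: h; exists z^-1; rewrite ?invr_eq0 //; apply/max_idealV; rewrite ?invr_eq0 //.
  by rewrite invrK.
have {step}[next nextP] := choice step.
pose y i := iter i next x.
have yP i : P (y i) /\ y i != 0.
  by elim: i => [//|i [Pi i0]] /=; case: (nextP _ Pi i0).
have ylt i j : (i < j)%N -> P (y i / y j).
  have yS k : P (y k / y k.+1) by have [Pk k0] := yP k; case: (nextP _ Pk k0).
  elim: j => // j IHj; rewrite ltnS leq_eqVlt => /predU1P[->//|ltij].
  have -> : y i / y j.+1 = (y i / y j) * (y j / y j.+1).
    by field; rewrite !(yP _).2.
  by apply: max_idealMr; [exact: IHj | exact: max_ideal_vring].
have [c hc] := dependent_powers x.
have [N [a [i [j aij]] sum0]] := hc (fun i => y i).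
suff /(_ (i, j))/eqP : forall ij : 'I_c * 'I_N, a ij.1 ij.2 = 0 by rewrite (negbTE aij).
apply: (@distinct_valuations_free ('I_c * 'I_N)%type
  (fun ij => y ij.1 * x ^+ ij.2) (fun ij => a ij.1 ij.2)).
- by move=> [k l] /=; rewrite mulf_neq0 ?expf_neq0 ?(yP _).2.
(* As 0 < v(y_k) <= v(x), the valuations are ordered first by the exponent of [x], then by the index
   in the chain. *)
- suff main (k k' : 'I_c) (l l' : 'I_N) : (l' < l)%N ->
      P (y k * x ^+ l / (y k' * x ^+ l')).
    move=> [k l] [k' l']; rewrite xpair_eqE negb_and /=.
    have [lt _|lt _|/val_inj eq] := ltngtP l' l; [left|right|]; try exact: main.
    rewrite eq eqxx orbF -val_eqE neq_ltn => /orP[] lt; [left|right].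
      rewrite -mulf_div divff ?expf_neq0 // mulr1; exact: ylt.
    rewrite -mulf_div divff ?expf_neq0 // mulr1; exact: ylt.
  move=> lt; have -> : y k * x ^+ l / (y k' * x ^+ l') =
      y k * (x ^+ (l - l').-1 * (x / y k')).
    have -> : x ^+ l = x ^+ l' * x ^+ (l - l').-1 * x.
      by rewrite -exprD -exprSr; congr (x ^+ _); lia.
    by field; rewrite (yP _).2 expf_neq0.
  apply: max_idealMr; first exact: (yP k).1.
  apply: vringM; first exact/vringX/max_ideal_vring.
  case: (nat_of_ord k') => [|k'']; first by rewrite divff //; apply: vring1.
  by apply: max_ideal_vring; apply: (ylt 0%N).
- by rewrite pair_big /= in sum0.
Qed.

(** * The order function at a place *)

Section Order.
Variable (t : E).
Hypothesis t_unif : uniformizer O t.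

Lemma uniformizer_ideal : P t.
Proof. by rewrite t_unif; exists 1; rewrite ?mulr1 //; apply: vring1. Qed.

Lemma uniformizer_neq0 : t != 0.
Proof.
apply/negP => /eqP t0; case: Oval => _ [_ nT] _ _; apply: nT => z _.
have [->|z0] := eqVneq z 0; first exact: vring0.
apply: contrapT => nOz; have : P z^-1.
  by apply/max_idealV; rewrite ?invr_eq0 // invrK.
by rewrite t_unif => -[u _ /esym/eqP]; rewrite t0 mul0r invr_eq0 (negbTE z0).
Qed.

Let Pt := uniformizer_ideal.
Let t0 := uniformizer_neq0.

(** If every power of [t] divided [z], the valuations of the z^i t^j would be ordered
    lexicographically, first by i, and hence be distinct, against [dependent_powers] for [t]. *)
Lemma uniformizer_archimedean z : z != 0 -> exists n, ~ O (z / t ^+ n).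
Proof.
move=> z0; apply: contrapT => h.
have Ozt n : O (z / t ^+ n) by apply: contrapT => nO; apply: h; exists n.
have Pzt n : P (z / t ^+ n).
  have -> : z / t ^+ n = t * (z / t ^+ n.+1).
    by rewrite exprS; field; rewrite t0 expf_neq0.
  exact: max_idealMr.
have Ot := max_ideal_vring Pt.
have Oz : O z by have := Ozt 0%N; rewrite expr0 divr1.
have [c hc] := dependent_powers t.
have [N [a [i [j aij]] sum0]] := hc (fun i => z ^+ i).
suff /(_ (i, j))/eqP : forall ij : 'I_c * 'I_N, a ij.1 ij.2 = 0 by rewrite (negbTE aij).
apply: (@distinct_valuations_free ('I_c * 'I_N)%type
  (fun ij => z ^+ ij.1 * t ^+ ij.2) (fun ij => a ij.1 ij.2)).
- by move=> [k l] /=; rewrite mulf_neq0 ?expf_neq0.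
- suff main (k k' : 'I_c) (l l' : 'I_N) : (k' < k)%N ->
      P (z ^+ k * t ^+ l / (z ^+ k' * t ^+ l')).
    move=> [k l] [k' l']; rewrite xpair_eqE negb_and /=.
    have [lt _|lt _|/val_inj eq] := ltngtP k' k; [left|right|]; try exact: main.
    have tlt (m n : nat) : (m < n)%N -> P (t ^+ n / t ^+ m).
      move=> lt; have -> : t ^+ n / t ^+ m = t * t ^+ (n - m).-1.
        have -> : t ^+ n = t ^+ m * t ^+ (n - m).-1 * t.
          by rewrite -exprD -exprSr; congr (t ^+ _); lia.
        by field; rewrite expf_neq0.
      by apply: max_idealMr => //; apply: vringX.
    rewrite eq eqxx /= -val_eqE neq_ltn => /orP[] lt; [right|left];
      by rewrite -mulf_div divff ?expf_neq0 // mul1r; apply: tlt.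
  move=> lt; have -> : z ^+ k * t ^+ l / (z ^+ k' * t ^+ l') =
      z / t ^+ l' * (z ^+ (k - k').-1 * t ^+ l).
    have -> : z ^+ k = z ^+ k' * z ^+ (k - k').-1 * z.
      by rewrite -exprD -exprSr; congr (z ^+ _); lia.
    by field; rewrite !expf_neq0.
  by apply: max_idealMr => //; apply: vringM; apply: vringX.
- by rewrite pair_big /= in sum0.
Qed.

Lemma val_unitV u : val_unit O u -> val_unit O u^-1.
Proof. by case=> Ou u0 Ou'; split; rewrite ?invr_eq0 ?invrK. Qed.

Lemma val_unitM u v : val_unit O u -> val_unit O v -> val_unit O (u * v).
Proof.
case=> Ou u0 Ou' [Ov v0 Ov']; split; [exact: vringM | exact: mulf_neq0 |].
by rewrite invfM; apply: vringM.
Qed.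

Lemma val_unitXz u (n : int) : val_unit O u -> val_unit O (u ^ n).
Proof.
have pos (v : E) (m : nat) : val_unit O v -> val_unit O (v ^+ m).
  case=> Ov v0 Ov'; split; [exact: vringX | exact: expf_neq0 |].
  by rewrite -exprVn; apply: vringX.
by case: n => m uu; [exact: pos | rewrite NegzE -exprnN; apply/val_unitV/pos].
Qed.

Lemma valuation_factor z : z != 0 ->
  exists (n : int) u, val_unit O u /\ z = t ^ n * u.
Proof.
have main w : w != 0 -> O w -> exists (n : int) u, val_unit O u /\ w = t ^ n * u.
  move=> w0 Ow; have [n0 hn0] := uniformizer_archimedean w0.
  pose nO n := `[< ~ O (w / t ^+ n) >].
  have exn : exists n, nO n by exists n0; apply/asboolP.
  (* The least exponent leaving [O] is not 0, as [w] is in [O]; its predecessor [n] is the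
     valuation. *)
  case: (ex_minnP exn) => -[/asboolP[]|n /asboolP nOn minn].
    by rewrite expr0 divr1.
  exists n%:Z, (w / t ^+ n); split; last by rewrite mulrC divfK // expf_neq0.
  have wn0 : w / t ^+ n != 0 by rewrite mulf_neq0 // invr_eq0 expf_neq0.
  have Own : O (w / t ^+ n).
    by apply: contrapT => h; have := minn n (introT (asboolP _) h); rewrite ltnn.
  split=> //; apply: contrapT => h.
  have : P (w / t ^+ n) by apply/max_idealV.
  rewrite t_unif => -[u Ou] eu; apply: nOn.
  have -> : w / t ^+ n.+1 = w / t ^+ n / t by rewrite exprS; field; rewrite t0 expf_neq0.
  by rewrite -eu mulrAC divff // mul1r.
move=> z0; have [/main|/main] := vringV z; first exact.
rewrite invr_eq0 => /(_ z0) [n [u [uu e]]]; exists (- n), u^-1; split.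
  exact: val_unitV.
by rewrite -[z]invrK e invfM -invr_expz.
Qed.

Lemma unit_pow_uniformizer (n : int) : val_unit O (t ^ n) -> n = 0.
Proof.
have pos (m : nat) : ~ val_unit O (t ^+ m.+1).
  case=> _ tm0 nO; have : P (t ^+ m.+1).
    by rewrite exprS; apply: max_idealMr => //; apply: vringX; apply: max_ideal_vring.
  by move/(max_idealV tm0).
case: n => [[|m]|m] // => [/pos //|].
by rewrite NegzE -exprnN => /val_unitV; rewrite invrK => /pos.
Qed.

Lemma uniformizer_assoc s : uniformizer O s -> exists2 u, val_unit O u & s = t * u.
Proof.
move=> s_unif.
have Ps : P s by rewrite s_unif; exists 1; rewrite ?mulr1 //; apply: vring1.
have [u Ou eu] : [set t * y | y in O] s by rewrite -t_unif.
have [v Ov ev] : [set s * y | y in O] t by rewrite -s_unif.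
have uv : u * v = 1 by apply: (mulfI t0); rewrite mulrA eu ev mulr1.
have u0 : u != 0.
  by apply: contra_eq_neq uv => ->; rewrite mul0r eq_sym oner_eq0.
exists u => //; split=> //; suff -> : u^-1 = v by [].
by apply: (mulfI u0); rewrite divff.
Qed.

(** The definition of [ord] admits any uniformizer. Two of them differ by a unit, so the exponent
    does not depend on the choice. *)
Lemma ordE (n : int) u : val_unit O u -> ord O (t ^ n * u) = n.
Proof.
move=> uu; rewrite /ord; case: xgetP => [m _ [s [v [s_unif vu e]]]|/(_ n)[]]; last first.
  by exists t, u.
have [w wu sw] := uniformizer_assoc s_unif.
move: e; rewrite sw expfzMl.
move=> e; apply/esym/eqP; rewrite -subr_eq0; apply/eqP/unit_pow_uniformizer.
have -> : t ^ (n - m) = w ^ m * v * u^-1.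
  case: (uu) => _ u0 _; apply: (mulIf u0); rewrite mulfVK //.
  apply: (mulfI (expfz_neq0 m t0)); rewrite mulrA -expfzDr // subrKC e; ring.
by apply: val_unitM; [apply: val_unitM => //; exact: val_unitXz | exact: val_unitV].
Qed.

(** This turns bounds on orders into membership in [O], so that Riemann-Roch spaces can be handled
    by the ring operations of [O]. *)
Lemma ord_ge z (n : int) : z != 0 -> (n <= ord O z) = `[< O (z * t ^ (- n)) >].
Proof.
move=> z0; have [m [u [uu ->]]] := valuation_factor z0; rewrite ordE //.
have -> : t ^ m * u * t ^ (- n) = t ^ (m - n) * u by rewrite expfzDr //; ring.
case: (uu) => Ou u0 Ou'.
have Ot := max_ideal_vring Pt.
apply/idP/asboolP => [le|Oz].
  apply: vringM => //; have -> : m - n = `|m - n|%N%:Z by lia.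
  exact: vringX.
rewrite leNgt; apply/negP => lt.
have : O (t ^ (m - n)).
  have -> : t ^ (m - n) = t ^ (m - n) * u * u^-1 by rewrite mulfK.
  exact: vringM.
have -> : m - n = - (`|n - m|%N.-1.+1)%:Z by lia.
rewrite -exprnN => Oi.
suff /unit_pow_uniformizer : val_unit O (t ^ (`|n - m|%N.-1.+1)%:Z) by [].
by split=> //; [exact: vringX | exact: expf_neq0].
Qed.

End Order.

End ValuationRing.

(** * Riemann-Roch spaces and Goppa codes *)

Lemma scaled_product (F : fieldType) (f z t s : F) (p : int) (k : nat) : t != 0 ->
  f ^+ k * z * s = (f * t ^ p) ^+ k * (z * t ^ (- (p * k%:Z))) * s.
Proof.
move=> t0; rewrite exprMn mulrACA.
have -> : (t ^ p) ^+ k = t ^ (p * k%:Z) by rewrite -exprz_exp.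
by rewrite -expfzDr // subrr expr0z mulr1.
Qed.

Section RiemannRoch.
Variables (K : fieldType) (E : functionField K).

Local Notation iota := (ff_const E).

(** A nonzero value is not the default 0 of [quot_dim], hence a genuine dimension. *)
Lemma quot_dimP (V W : set E) :
  quot_dim V W != 0%N -> has_quot_dim V W (quot_dim V W).
Proof. by rewrite /quot_dim; case: xgetP => [d _ hd|_]; rewrite ?eqxx. Qed.

Lemma quot_basis_free (V : set E) d (b : 'I_d -> E) : V 0 ->
  (forall v, V v -> exists! c : 'rV[K]_d,
     [set 0] (v - \sum_i iota (c 0 i) * b i)) ->
  forall u : 'rV[K]_d, \sum_i iota (u 0 i) * b i = 0 -> u = 0.
Proof.
move=> V0 /(_ _ V0)[c [_ uniq]] u hu.
rewrite -(uniq u) /=; last by rewrite hu subr0.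
apply: uniq => /=; rewrite big1 ?subr0 // => i _.
by rewrite mxE rmorph0 mul0r.
Qed.

(** Multiplication by [f] is K-linear and injective; for d' < d it would send a basis to dependent
    vectors. *)
Lemma has_quot_dim_le (V V' : set E) d d' (f : E) : f != 0 -> V 0 ->
  (forall v, V v -> V' (f * v)) ->
  has_quot_dim V [set 0] d -> has_quot_dim V' [set 0] d' -> (d <= d')%N.
Proof.
move=> f0 V0 fV [b [Vb hb]] [b' [Vb' hb']]; rewrite leqNgt; apply/negP => lt.
have /choice[c hc] : forall i, exists c : 'rV[K]_d', f * b i = \sum_j iota (c 0 j) * b' j.
  move=> i; have [c [hc _]] := hb' _ (fV _ (Vb i)); exists c.
  by apply/eqP; rewrite -subr_eq0; apply/eqP.
have [u /eqP u0 uA] := rowspace_dependent (\matrix_(i, j) c i 0 j) lt.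
apply/u0/(quot_basis_free V0 hb)/(mulfI f0).
rewrite mulr0 mulr_sumr.
under eq_bigr do rewrite mulrCA hc mulr_sumr.
rewrite exchange_big big1 //= => j _.
under eq_bigr do rewrite mulrA -rmorphM.
rewrite -mulr_suml -rmorph_sum.
have /rowP/(_ j) := uA; rewrite !mxE => uAj.
rewrite -[X in iota X]/(\sum_i u 0 i * c i 0 j) (_ : \sum_i _ = 0) ?rmorph0 ?mul0r //.
by rewrite -[RHS]uAj; apply: eq_bigr => i _; rewrite mxE.
Qed.

Definition local_param (O : set E) : E := xget 0 [set t | uniformizer O t].

Lemma local_paramP (O : set E) : valuation_ring O -> uniformizer O (local_param O).
Proof. by move=> Oval; apply: xgetPex (exists_uniformizer Oval). Qed.

Lemma local_param_neq0 (O : set E) : valuation_ring O -> local_param O != 0.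
Proof. by move=> Oval; apply: uniformizer_neq0 (local_paramP Oval). Qed.

Lemma rrspaceP (A : set E -> int) z : riemann_roch_space A z <->
  forall O, valuation_ring O -> O (z * local_param O ^ A O).
Proof.
split=> [[->|h] O Oval|h].
- by rewrite mul0r; apply: vring0.
- have [->|z0] := eqVneq z 0; first by rewrite mul0r; apply: vring0.
  have := h O Oval.
  by rewrite (ord_ge Oval (local_paramP Oval)) // opprK => /asboolP.
- have [->|z0] := eqVneq z 0; first by left.
  right=> O Oval; rewrite (ord_ge Oval (local_paramP Oval)) // opprK.
  by apply/asboolP; apply: h.
Qed.

Lemma rrspace0 (A : set E -> int) : riemann_roch_space A 0.
Proof. by left. Qed.

Lemma rrspace_sum (A : set E -> int) (I : finType) (c : I -> K) (z : I -> E) :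
  (forall i, riemann_roch_space A (z i)) ->
  riemann_roch_space A (\sum_i iota (c i) * z i).
Proof.
move=> hz; apply/rrspaceP => O Oval; rewrite mulr_suml.
apply: vring_sum => // i _; rewrite -mulrA.
apply: vringM => //; first exact: vring_const.
by move/rrspaceP: (hz i); apply.
Qed.

(** [O] modulo its maximal ideal is a line over K, and [ev] is the coordinate on it with respect to
    some basis vector: the residue map up to a nonzero scalar, which has the same zeros. *)
Lemma residue_functional (O : set E) : rational_places E O ->
  exists ev : E -> K, (forall v, O v -> ev v = 0 -> max_ideal O v) /\
    forall (I : finType) (c : I -> K) (z : I -> E), (forall i, O (z i)) ->
      ev (\sum_i iota (c i) * z i) = \sum_i c i * ev (z i).
Proof.
case=> Oval deg1.
have := @quot_dimP O (max_ideal O); rewrite -/(place_degree O) deg1.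
case=> // b [Ob hb].
have {hb} hb v : O v -> exists! c, max_ideal O (v - iota c * b ord0).
  move=> /hb[c [hc uniq]]; exists (c 0 0); split; first by rewrite big_ord1 in hc.
  move=> c' hc'; rewrite (uniq (const_mx c')) ?mxE //.
  by rewrite big_ord1 mxE.
pose ev v := xget 0 [set c | max_ideal O (v - iota c * b ord0)].
have evP v : O v -> max_ideal O (v - iota (ev v) * b ord0).
  move=> /hb[c [hc _]].
  by apply: (@xgetPex _ 0 [set c | max_ideal O (v - iota c * b ord0)]); exists c.
exists ev; split=> [v Ov ev0|I c z Oz].
  by have := evP v Ov; rewrite ev0 rmorph0 mul0r subr0.
have Os : O (\sum_i iota (c i) * z i).
  by apply: vring_sum => // i _; apply: vringM => //; apply: vring_const.
have [e [_ uniq]] := hb _ Os.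
rewrite -(uniq _ (evP _ Os)); apply: uniq.
rewrite rmorph_sum mulr_suml -sumrB; apply: max_ideal_sum => // i _.
rewrite rmorphM -mulrA -mulrBr; apply: max_idealMl => //; first exact: vring_const.
exact: evP.
Qed.

(** * Divisors supported at given rational places *)

Section Places.
Variables (n : nat) (pl : 'I_n -> set E).
Hypothesis pl_inj : injective pl.
Hypothesis pl_rat : forall i, rational_places E (pl i).

(** At most one term occurs when [pl] is injective; the form as a sum makes sign and scaling of [w]
    pass through. *)
Definition place_divisor (w : 'I_n -> int) : set E -> int :=
  fun O => \sum_(i | `[< O = pl i >]) w i.

Lemma place_divisorE w i : place_divisor w (pl i) = w i.
Proof.
rewrite /place_divisor (big_pred1 i) // => j.
by apply/asboolP/eqP => [/pl_inj|->].
Qed.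

Lemma place_divisor0 w O : (forall i, O <> pl i) -> place_divisor w O = 0.
Proof. by move=> h; rewrite /place_divisor big1 // => i /asboolP /h. Qed.

Lemma place_divisor_supp w O : place_divisor w O != 0 -> exists i, O = pl i.
Proof.
move=> wO; apply: contrapT => h; case/negP: wO; apply/eqP.
by apply: place_divisor0 => i e; apply: h; exists i.
Qed.

Lemma place_divisorP w : is_divisor (place_divisor w).
Proof.
split=> [|O /place_divisor_supp[i ->]]; last by case: (pl_rat i).
apply: (@sub_finite_set _ _ (range pl)); last exact/finite_image/finite_finset.
by move=> O /place_divisor_supp[i ->]; exists i.
Qed.

Lemma place_divisor_degree w : div_degree (place_divisor w) = \sum_i w i.
Proof.
rewrite /div_degree (@fsbigE _ _ _ _ _ [seq pl i | i <- enum 'I_n]); first last.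
- move=> O _ nO; rewrite place_divisor0 ?mul0r // => i e.
  by move/negP: nO; apply; rewrite e map_f // mem_enum.
- by move=> O /= /mapP[i _ ->]; case: (pl_rat i).
- by rewrite map_inj_uniq // enum_uniq.
rewrite big_map big_enum_cond /=; apply: eq_big => [i|i _].
  by apply/mem_set; case: (pl_rat i).
by rewrite place_divisorE (pl_rat i).2 mulr1.
Qed.

Lemma riemann_inequality g w : has_genus E g ->
  \sum_i w i + 1 <= (ell (place_divisor w))%:Z + g%:Z.
Proof.
case=> _ /(_ _ (place_divisorP w)); rewrite place_divisor_degree.
by move: (\sum_i w i) (ell _) => x y; lia.
Qed.

(* If deg B < 0 for some nonzero f in L(B), multiplication by f ^ k embeds
   L(- k B) in L(0), whose dimension does not depend on k; the genus bounds
   deg(- k B) - ell(- k B) from above, which fails for k large. *)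
Lemma rrspace_degree_ge0 g w f (i0 : 'I_n) : has_genus E g -> f != 0 ->
  riemann_roch_space (place_divisor w) f -> 0 <= \sum_i w i.
Proof.
move=> hg f0 /rrspaceP Lf; rewrite leNgt; apply/negP => wlt0.
(* The target space is L(g P) for P = [pl i0], which contains L(0): in degree [g] Riemann's
   inequality makes its dimension [M] nonzero, so [quot_dimP] applies. *)
pose w0 i := if i == i0 then g%:Z else 0.
pose M := ell (place_divisor w0).
have sw0 : \sum_i w0 i = g%:Z by rewrite /w0 -big_mkcond big_pred1_eq.
have Mgt0 : M != 0%N.
  by have := riemann_inequality w0 hg; rewrite sw0 -/M; case: (M) => //; lia.
(* The degree of [- k B] is at least [g + M], so Riemann's inequality gives a dimension above
   [M]. *)
pose k := (g + M)%N.
pose wk i := - (w i) * k%:Z.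
have arith (x : int) (y : nat) : x < 0 ->
  - x * (g + M)%:Z + 1 <= y%:Z + g%:Z -> (M < y)%N by nia.
have := riemann_inequality wk hg; rewrite -mulr_suml sumrN => /(arith _ _ wlt0) ltM.
have d0 : ell (place_divisor wk) != 0%N by rewrite -lt0n (leq_ltn_trans _ ltM).
suff : (ell (place_divisor wk) <= M)%N by rewrite leqNgt ltM.
apply: (has_quot_dim_le (expf_neq0 k f0)) (quot_dimP d0) (quot_dimP Mgt0).
  exact: rrspace0.
move=> z /rrspaceP Lz; apply/rrspaceP => O Oval.
have t0 := local_param_neq0 Oval; set t := local_param O in t0.
(* The three factors lie in [O] because [f] is in L(B), [z] is in L(- k B), and the last exponent is
   nonnegative. *)
have -> : f ^+ k * z * t ^ place_divisor w0 O =
    (f * t ^ place_divisor w O) ^+ k * (z * t ^ place_divisor wk O) *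
    t ^ place_divisor w0 O.
  have -> : place_divisor wk O = - (place_divisor w O * k%:Z).
    by rewrite /place_divisor -mulNr -sumrN mulr_suml.
  exact: scaled_product.
apply: vringM => //.
  by apply: vringM; [| apply: vringX; last exact: Lf | exact: Lz].
have -> : place_divisor w0 O = `|place_divisor w0 O|%N%:Z.
  have : 0 <= place_divisor w0 O.
    by apply: sumr_ge0 => i _; rewrite /w0; case: ifP.
  by lia.
apply: vringX => //; apply: max_ideal_vring.
exact: uniformizer_ideal (local_paramP Oval).
Qed.

End Places.

(** Place 0 carries the pole and the other [N] are evaluation points. If [f] in L(m P_0) vanishes at
    the places in [Z], it lies in the space of m P_0 minus their sum, so [m - #|Z|] is
    nonnegative. *)
Lemma goppa_code (g N m : nat) (pl : 'I_N.+1 -> set E) :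
  has_genus E g -> injective pl -> (forall i, rational_places E (pl i)) ->
  (g <= m)%N ->
  exists k (G : 'M[K]_(k, N)), (m < k + g)%N /\
    forall u : 'rV[K]_k, u != 0 -> (#|[set j | (u *m G) 0%R j == 0%R]%SET| <= m)%N.
Proof.
move=> hg pl_inj pl_rat gm.
pose w (i : 'I_N.+1) : int := if i == ord0 then m%:Z else 0.
pose A := place_divisor pl w.
have sw : \sum_i w i = m%:Z by rewrite /w -big_mkcond big_pred1_eq.
have := riemann_inequality pl_inj pl_rat w hg; rewrite sw -/A => ellA.
have /quot_dimP[b [Lb hb]] : ell A != 0%N by case: (ell A) ellA => //; lia.
rewrite -/(ell A) in b Lb hb *.
have /choice[ev evP] (j : 'I_N) := residue_functional (pl_rat (lift ord0 j)).
exists (ell A), (\matrix_(i, j) ev j (b i)); split; first by move: (ell A) ellA => x; lia.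
move=> u u0.
pose f := \sum_i iota (u 0 i) * b i.
have Lpl z (j : 'I_N) : riemann_roch_space A z -> pl (lift ord0 j) z.
  move=> /rrspaceP /(_ _ (pl_rat (lift ord0 j)).1).
  by rewrite /A place_divisorE // expr0z mulr1.
have Lf : riemann_roch_space A f by apply: rrspace_sum.
have f0 : f != 0.
  by apply: contraNneq u0 => /(quot_basis_free (rrspace0 A) hb) ->.
set Z := [set j | _]%SET.
have Zf j : j \in Z -> max_ideal (pl (lift ord0 j)) f.
  have [ev0 evsum] := evP j.
  rewrite inE mxE => /eqP uG; apply: ev0; first exact: Lpl.
  rewrite evsum => [|i]; last exact: Lpl.
  by rewrite -[RHS]uG; apply: eq_bigr => i _; rewrite mxE.
pose w' (i : 'I_N.+1) : int :=
  w i - (if unlift ord0 i is Some j then (j \in Z)%:Z else 0).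
have : riemann_roch_space (place_divisor pl w') f.
  apply/rrspaceP => O Oval.
  have [[i e]|nO] := pselect (exists i, O = pl i); last first.
    rewrite place_divisor0 => [|i e]; last by apply: nO; exists i.
    have /rrspaceP/(_ O Oval) := Lf.
    by rewrite /A place_divisor0 // => i e; apply: nO; exists i.
  rewrite e place_divisorE // /w'; case: unliftP => [j ij|ij]; last first.
    have /rrspaceP/(_ O Oval) := Lf.
    by rewrite e /A place_divisorE // subr0.
  rewrite /w ij eq_sym eq_liftF; case: (boolP (j \in Z)) => [jZ|_].
    (* At a zero, [f] is a multiple of the local parameter, so dividing by the parameter stays in
       [O]. *)
    rewrite sub0r; have := Zf j jZ; rewrite -ij -e.
    rewrite (local_paramP Oval) => -[y Oy <-].
    by rewrite mulrAC divff ?mul1r // local_param_neq0.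
  by rewrite subr0 expr0z mulr1; apply: Lpl.
move/(rrspace_degree_ge0 pl_inj pl_rat ord0 hg f0).
rewrite sumrB sw subr_ge0 big_ord_recl unlift_none add0r.
under eq_bigr do rewrite liftK.
have -> // : \sum_j (j \in Z)%:Z = #|Z|%:Z.
rewrite -sum1_card (big_morph Posz PoszD (erefl _)) [RHS]big_mkcond /=.
by apply: eq_bigr => j _; case: (j \in Z).
Qed.

End RiemannRoch.

(** * The choice of parameters *)

Section Limits.
Variable R : realType.
Implicit Types (u : (\bar R)^nat) (l : \bar R).

Lemma limn_esup_gt u l n0 : (l < limn_esup u)%E ->
  exists n, (n0 <= n)%N /\ (l < u n)%E.
Proof.
move=> lu; apply: contrapT => h; move: lu; rewrite ltNge => /negP; apply.
apply: (@le_trans _ _ (ereal_sup [set u n | n in [set n | (n0 <= n)%N]])).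
  by apply: ereal_inf_lbound; exists [set n | (n0 <= n)%N] => //; exists n0.
apply: ge_ereal_sup => _ [n /= n0n <-]; rewrite leNgt; apply/negP => lun.
by apply: h; exists n.
Qed.

Lemma limn_einf_ge u l : (\forall n \near \oo, l <= u n)%E -> (l <= limn_einf u)%E.
Proof.
case=> n0 _ h; rewrite /limn_einf leeNr.
apply: (@le_trans _ _ (ereal_sup [set (- u n)%E | n in [set n | (n0 <= n)%N]])).
  by apply: ereal_inf_lbound; exists [set n | (n0 <= n)%N] => //; exists n0.
by apply: ge_ereal_sup => _ [n /= n0n <-]; rewrite leeN2; apply: h.
Qed.

Lemma limn_esup_ge0 u : (forall n, 0 <= u n)%E -> (0 <= limn_esup u)%E.
Proof.
move=> u0; apply: le_ereal_inf_tmp => _ [V [n0 _ hV] <-].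
apply: le_trans (u0 n0) _; apply: ereal_sup_ubound; exists n0 => //.
exact: hV (leqnn n0).
Qed.

End Limits.

(** A positive value is not the default 0 of [xget], so a function field attains the maximum. *)
Lemma many_rational_places (K : finFieldType) (g : nat) :
  (0 < max_rational_places K g)%N ->
  exists (E : functionField K) (pl : 'I_(max_rational_places K g) -> set E),
    [/\ has_genus E g, injective pl & forall i, rational_places E (pl i)].
Proof.
rewrite /max_rational_places; case: xgetP => // N _ [[E [hg cardE]] _] _.
have /card_set_bijP[f [fI finj _]] : (`I_N #= rational_places E)%card by rewrite card_eq_sym.
exists E, (fun i : 'I_N => f i); split=> // [i j e|i]; last by apply: fI => /=.
by apply/val_inj/finj; rewrite ?inE /=.
Qed.

(** One place is reserved for the pole; cutting the other [N - 1] into blocks of length [r] wastes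
    at most [r - 1]. *)
Lemma block_count (r N : nat) : (0 < r)%N -> (0 < N)%N ->
  ((N.-1 %/ r * r).+1 <= N)%N /\ (N <= N.-1 %/ r * r + r)%N.
Proof.
move=> r0 N0; have := leq_trunc_div N.-1 r; have := ltn_ceil N.-1 r0.
by rewrite mulSn; lia.
Qed.

Section Existence.
Variables (R : realType) (K : finFieldType) (r : nat) (hr : (0 < r)%N).

Local Notation s := (r%:R / r.+1%:R : R).

(** Of the s n data coordinates, about delta n pay for the distance and about c n for the genus, as
    g < N / a and s / a = c; about rho n remain. The gap between [rho'] and [rho] absorbs the
    rounding. *)
Lemma locally_repairable_above_ihara (delta rho rho' : R) (n0 : nat) :
  0 <= delta -> 0 < rho' -> rho' < rho -> 0 < s - delta - rho ->
  ((s / (s - delta - rho))%:E < ihara R K)%E ->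
  exists n (C : {vspace 'rV[K]_n}), [/\ (n0 < n)%N, C != 0%VS,
    has_locality (codewords C) r,
    delta * n%:R <= (min_distance (codewords C))%:R & rho' * n%:R <= (\dim C)%:R].
Proof.
move=> delta0 rho'0 rho'rho; set c := s - delta - rho => c0.
have r1 : 0 < (r%:R : R) by rewrite ltr0n.
have rS : (r.+1%:R : R) = r%:R + 1 by rewrite -natr1.
have s0 : 0 < s by rewrite divr_gt0 // ltr0n.
set a := s / c => aA.
have a0 : 0 < a by rewrite divr_gt0.
(* For n > X the gap (rho - rho') n covers both losses: 1 from rounding [w], and r / a = (r + 1) c
   from the pole and the incomplete block. *)
pose X := n0%:R + (1 + r.+1%:R * c) / (rho - rho').
have [g [gX]] := limn_esup_gt (Num.truncn ((X + r%:R) / a)).+1 aA.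
rewrite lte_fin => ag.
have g0 : 0 < (g%:R : R) by rewrite ltr0n (leq_trans _ gX).
move: ag; rewrite ltr_pdivlMr // => agN.
have {}gX : X + r%:R < a * g%:R.
  rewrite mulrC -ltr_pdivrMr //; apply: lt_le_trans (truncnS_gt _) _.
  by rewrite ler_nat.
have XrN := lt_trans gX agN.
have X0 : n0%:R <= X.
  rewrite /X lerDl; apply: divr_ge0; last by rewrite subr_ge0 ltW.
  by rewrite addr_ge0 // mulr_ge0 // ltW.
have Ngt0 : (0 < max_rational_places K g)%N.
  by rewrite -(ltr0n R); have := ler0n R n0; lra.
have [E [pl [hg pl_inj pl_rat]]] := many_rational_places Ngt0.
set N := max_rational_places K g in XrN agN Ngt0 pl pl_inj pl_rat.
pose B := (N.-1 %/ r)%N.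
have [ltBN leNB] := block_count hr Ngt0; rewrite -/B in ltBN leNB.
have leNB' : N%:R <= B%:R * r%:R + r%:R :> R by rewrite -natrM -natrD ler_nat.
pose n := (B * r.+1)%N.
have nE : n%:R = B%:R * r%:R + B%:R :> R by rewrite -natrM -natrD /n mulnS addnC.
have snE : s * n%:R = B%:R * r%:R.
  by rewrite /n natrM; field; apply: lt0r_neq0; lra.
have XB : X < B%:R * r%:R by lra.
have Bn : B%:R * r%:R <= n%:R :> R by rewrite nE lerDl.
(* The successor keeps [w] positive even for [delta = 0], as injectivity of the encoding
   requires. *)
pose w := (Num.truncn (delta * n%:R)).+1.
have wgt : delta * n%:R < w%:R by apply: truncnS_gt.
have wle : w%:R <= delta * n%:R + 1.
  by rewrite /w -natr1 lerD2r truncn_le mulr_ge0.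
have gle : g%:R < n%:R * c + r.+1%:R * c.
  have : g%:R < N%:R / a by rewrite ltr_pdivlMr // mulrC.
  move=> /lt_le_trans; apply.
  have -> : n%:R * c + r.+1%:R * c = (B%:R * r%:R + r%:R) / a.
    rewrite -snE /a; field.
    by rewrite !lt0r_neq0 //; lra.
  by rewrite ler_pM2r // invr_gt0.
have slack : 1 + r.+1%:R * c <= (rho - rho') * n%:R.
  rewrite [leRHS]mulrC -ler_pdivrMr ?subr_gt0 //.
  by apply: le_trans (ltW (lt_le_trans XB Bn)); rewrite /X lerDr ler0n.
(* With [m = B * r - w] this reads m - g > rho' n, and the Goppa code has dimension above m - g. *)
have main : rho' * n%:R + g%:R < B%:R * r%:R - w%:R.
  have -> : B%:R * r%:R = (c + delta + rho) * n%:R by rewrite -snE /c; ring.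
  by nra.
have rho'n : 0 <= rho' * n%:R by rewrite mulr_ge0 // ltW.
have lewB : (w <= B * r)%N by rewrite -(ler_nat R) natrM; lra.
have legm : (g <= B * r - w)%N.
  by rewrite -(ler_nat R) natrB // natrM; lra.
pose pl' (i : 'I_(B * r).+1) := pl (widen_ord ltBN i).
have pl'_inj : injective pl' by move=> i j /pl_inj /(congr1 val) /= /val_inj.
have [k [G [km wtG]]] := goppa_code hg pl'_inj (fun i => pl_rat _) legm.
have dimk : rho' * n%:R < k%:R.
  have : (B * r - w)%:R < (k + g)%:R :> R by rewrite ltr_nat.
  by rewrite natrB // natrM natrD; lra.
have k0 : (0 < k)%N by rewrite -(ltr0n R); lra.
have weightG u : u != 0 -> (w <= weight (u *m G))%N.
  move=> /wtG zeros; have wtE := card_zeros_weight (u *m G).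
  rewrite -(leq_add2l #|[set j | (u *m G) 0%R j == 0%R]%SET|) wtE.
  by apply: leq_trans (leq_add zeros (leqnn w)) _; rewrite subnK.
have [C [C0 locC dC dimC]] := locally_repairable_of_generator (ltn0Sn _) lewB k0 weightG.
exists n, C; split=> //.
- by rewrite -(ltr_nat R); lra.
- by apply: le_trans (ltW wgt) _; rewrite ler_nat.
- by rewrite dimC ltW.
Qed.

End Existence.

(** * From single codes to the family *)

(** For finite positive [A], rho < tau means s - delta - rho > s / A, which rearranges to the claim.
    [A = 0] has inverse [+oo] and contradicts positivity of the bound; [A = +oo] has inverse 0. *)
Lemma ihara_rate_bound (R : realType) (A : \bar R) (s delta : R) :
  (0 <= A)%E -> 0 < s -> (0 < s%:E - A^-1 * s%:E - delta%:E)%E ->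
  exists tau, [/\ 0 < tau, (s%:E - A^-1 * s%:E - delta%:E)%E = tau%:E &
    forall rho, rho < tau -> 0 < s - delta - rho /\ ((s / (s - delta - rho))%:E < A)%E].
Proof.
move=> A0 s0; case: A A0 => [a| |] //.
- rewrite lee_fin => a0; rewrite /inve; case: (eqVneq a 0) => [_|an0].
    by rewrite gt0_mulye ?lte_fin.
  have {an0}a0 : 0 < a by rewrite lt0r an0.
  rewrite -EFinM -!EFinB lte_fin => tau0; exists (s - a^-1 * s - delta); split=> // rho lt.
  have as0 : 0 < a^-1 * s by rewrite mulr_gt0 // invr_gt0.
  have c0 : a^-1 * s < s - delta - rho by lra.
  split; first exact: lt_trans c0.
  rewrite lte_fin ltr_pdivrMr; last exact: lt_trans c0.
  by rewrite -ltr_pdivrMl.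
- move=> _; rewrite /inve mul0e sube0 -EFinB lte_fin => tau0.
  exists (s - delta); split=> // rho lt; rewrite subr_gt0; split=> //.
  by rewrite ltry.
Qed.

Lemma code_family (R : realType) (K : finFieldType) (r : nat) (delta : R)
    (l : \bar R) (v : nat -> R) :
  (forall e, 0 < e -> \forall i \near \oo, (l <= (v i + e)%:E)%E) ->
  (forall i, exists n (C : {vspace 'rV[K]_n}), [/\ (i < n)%N, C != 0%VS,
    has_locality (codewords C) r,
    delta * n%:R <= (min_distance (codewords C))%:R & v i * n%:R <= (\dim C)%:R]) ->
  exists (n : nat -> nat) (C : forall i, {vspace 'rV[K]_(n i)}),
    [/\ forall i, C i != 0%VS,
        forall i, has_locality (codewords (C i)) r,
        n i @[i --> \oo] --> \oo,
        (delta%:E <= limn_einf (fun i =>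
           ((min_distance (codewords (C i)))%:R / (n i)%:R)%:E))%E
      & (l <= limn_einf (fun i => ((\dim (C i))%:R / (n i)%:R)%:E))%E].
Proof.
move=> vl codes.
have {codes}/choice[f hf] i : exists nC : {n & {vspace 'rV[K]_n}},
    [/\ (i < projT1 nC)%N, projT2 nC != 0%VS, has_locality (codewords (projT2 nC)) r,
    delta * (projT1 nC)%:R <= (min_distance (codewords (projT2 nC)))%:R &
    v i * (projT1 nC)%:R <= (\dim (projT2 nC))%:R].
  by have [n [C h]] := codes i; exists (existT _ n C).
have n0 i : 0 < (projT1 (f i))%:R :> R.
  by rewrite ltr0n; have [/(leq_ltn_trans (leq0n i))] := hf i.
exists (fun i => projT1 (f i)), (fun i => projT2 (f i)); split.
- by move=> i; have [] := hf i.
- by move=> i; have [] := hf i.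
- apply/cvgnyPge => m; exists m => // i /= mi.
  by have [/ltnW lti _ _ _ _] := hf i; apply: leq_trans mi lti.
- apply: limn_einf_ge; exists 0%N => // i _.
  by rewrite lee_fin ler_pdivlMr //; have [] := hf i.
- apply/lee_addgt0Pr => e e0; rewrite -leeBlDr //.
  apply: limn_einf_ge; apply: filterS (vl e e0) => i li.
  rewrite leeBlDr //; apply: le_trans li _; rewrite -EFinD lee_fin lerD2r.
  by rewrite ler_pdivlMr //; have [] := hf i.
Qed.

Theorem theorem1p1 (R : realType) (K : finFieldType) (r : nat) (hr : (1 <= r)%N)
    (delta : R) (hdelta0 : 0 <= delta) (hdelta1 : delta <= 1) :
  exists (n : nat -> nat) (C : forall i, {vspace 'rV[K]_(n i)}),
    [/\ forall i, C i != 0%VS,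
        forall i, has_locality (codewords (C i)) r,
        n i @[i --> \oo] --> \oo,
        (delta%:E <= limn_einf (fun i =>
           ((min_distance (codewords (C i)))%:R / (n i)%:R)%:E))%E
      & ((r%:R / r.+1%:R)%:E - (ihara R K)^-1 * (r%:R / r.+1%:R)%:E - delta%:E
           <= limn_einf (fun i => ((\dim (C i))%:R / (n i)%:R)%:E))%E].
Proof.
set T := ((r%:R / r.+1%:R)%:E - (ihara R K)^-1 * (r%:R / r.+1%:R)%:E - delta%:E)%E.
have [T0|T0] := leP T 0%E.
  apply: (@code_family _ _ _ _ _ (fun=> 0)) => [e e0|i].
    by near=> i; apply: le_trans T0 _; rewrite add0r lee_fin ltW.
  (* A nonpositive bound asks nothing of the dimension, and relative distance 1 suffices by
     [delta <= 1]. The length [i + 2] exceeds both 1 and [i]. *)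
  have [C [C0 locC dC]] := @repetition_code K r i.+2 hr isT.
  exists i.+2, C; split=> //; last by rewrite mul0r.
  apply: (@le_trans _ _ i.+2%:R); last by rewrite ler_nat.
  by rewrite -[leRHS]mul1r ler_wpM2r.
have s0 : 0 < r%:R / r.+1%:R :> R by rewrite divr_gt0 // ltr0n.
have A0 : (0 <= ihara R K)%E by apply: limn_esup_ge0 => g; rewrite lee_fin divr_ge0.
have [tau [tau0 Ttau hrho]] := ihara_rate_bound A0 s0 T0.
(* The denominator starts at 2 so that the target rate is positive already for [i = 0]. *)
apply: (@code_family _ _ _ _ _ (fun i => tau - tau / i.+2%:R)) => [e e0|i].
  have et : 0 < e / tau by rewrite divr_gt0.
  have := near_infty_natSinv_lt (PosNum et); apply: filterS => i /= lti.
  rewrite /T Ttau lee_fin -addrA lerDl addrC subr_ge0.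
  rewrite mulrC -ler_pdivlMr //; apply: le_trans (ltW lti).
  by rewrite lef_pV2 ?posrE ?ltr0n // ler_nat.
have ti0 : 0 < tau / i.+2%:R by rewrite divr_gt0.
have ti1 : tau / i.+2%:R < tau by rewrite gtr_pMr // invf_lt1 ?ltr0n // ltr1n.
set t := tau / i.+2%:R in ti0 ti1 *.
(* [tau - t / 2] lies strictly between the target [tau - t] and [tau], which leaves room for the
   rounding. *)
have [|c0 cA] := hrho (tau - t / 2); first by lra.
by apply: (locally_repairable_above_ihara hr i hdelta0 _ _ c0 cA); lra.
Unshelve. all: by end_near.
Qed.
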